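(* Let $n\in\mathbb{N}$, $1<\alpha\le 3/2$, $\lambda\in\mathbb{C}$ with $|\lambda|\le\frac{1}{n+1}$, and let $f\in\mathcal{F}(\alpha,\lambda,n)$. Then there is a Schwarz function $\varpi$, i.e. an analytic function in $\mathbb{D}$ with $\varpi(0)=0$ and $|\varpi(z)|<1$ for $z\in\mathbb{D}$, such that for all $z\in\mathbb{D}$ $$f(z)=\int_0^z\exp\left(2(1-\alpha)\int_0^{\zeta}\frac{\varpi(t)}{t(1-\varpi(t))}\,dt\right)d\zeta+\overline{\lambda\int_0^z\zeta^{n}\exp\left(2(1-\alpha)\int_0^{\zeta}\frac{\varpi(t)}{t(1-\varpi(t))}\,dt\right)d\zeta}.$$
   Context: $\mathbb{D}=\{z\in\mathbb{C}:|z|<1\}$, $\mathbb{N}=\{1,2,3,\ldots\}$. $\mathcal{H}$ is the class of harmonic functions $f=h+\overline{g}$ in $\mathbb{D}$, with $h,g$ analytic in $\mathbb{D}$, normalized by $f(0)=f_z(0)-1=0$, of the form $f(z)=z+\sum_{k=2}^{\infty}a_kz^k+\overline{\sum_{k=1}^{\infty}b_kz^k}$. For $n\in\mathbb{N}$, $1<\alpha\le 3/2$ and $\lambda\in\mathbb{C}$ with $|\lambda|\le\frac1{n+1}$, $\mathcal{F}(\alpha,\lambda,n)$ is the class of $f=h+\overline{g}\in\mathcal{H}$ such that $\mathrm{Re}\left(1+\frac{zh''(z)}{h'(z)}\right)<\alpha$ and $g'(z)=\lambda z^nh'(z)$ for all $z\in\mathbb{D}$. *)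

(* Defs.v *)
From Stdlib Require Export Reals.
From Coquelicot Require Export Coquelicot.
Open Scope R_scope.

Definition in_disk (z : C) : Prop := Cmod z < 1.

(* Analytic in the disk means complex differentiable at each of its points;
   values outside the disk are irrelevant. *)
Definition analytic_in_disk (f : C -> C) : Prop :=
  forall z : C, in_disk z -> @ex_derive C_AbsRing C_NormedModule f z.

(* The Wirtinger derivative f_z = (f_x - i f_y) / 2; the partial derivatives
   are taken on real and imaginary parts, so that no complex
   differentiability of f is involved. *)
Definition Cderiv_x (f : C -> C) (z : C) : C :=
  (Derive (fun x : R => Re (f (x, Im z))) (Re z),
   Derive (fun x : R => Im (f (x, Im z))) (Re z)).
Definition Cderiv_y (f : C -> C) (z : C) : C :=
  (Derive (fun y : R => Re (f (Re z, y))) (Im z),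
   Derive (fun y : R => Im (f (Re z, y))) (Im z)).
Definition wirtinger (f : C -> C) (z : C) : C :=
  ((Cderiv_x f z - Ci * Cderiv_y f z) / 2)%C.

(* f belongs to the class H, with f = h + conj g as its decomposition:
   h(z) = z + sum_(k >= 2) a_k z^k and g(z) = sum_(k >= 1) b_k z^k.
   Such an f is harmonic because h and g are analytic. *)
Definition class_H (f h g : C -> C) : Prop :=
  analytic_in_disk h /\ analytic_in_disk g /\
  (forall z : C, in_disk z -> f z = (h z + Cconj (g z))%C) /\
  f (RtoC 0) = RtoC 0 /\
  (wirtinger f (RtoC 0) - 1)%C = RtoC 0 /\
  (exists a b : nat -> C,
     a 0%nat = RtoC 0 /\ a 1%nat = RtoC 1 /\ b 0%nat = RtoC 0 /\
     forall z : C, in_disk z ->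
       @is_pseries C_AbsRing C_NormedModule a z (h z) /\
       @is_pseries C_AbsRing C_NormedModule b z (g z)).

(* Division by zero is total in Coquelicot, so the definedness of h''/h' is
   spelled out as h' <> 0. *)
Definition class_F (alpha : R) (lambda : C) (n : nat) (f : C -> C) : Prop :=
  exists h g : C -> C,
    class_H f h g /\
    forall z : C, in_disk z ->
      C_derive h z <> RtoC 0 /\
      Re (1 + z * C_derive (C_derive h) z / C_derive h z)%C < alpha /\
      C_derive g z = (lambda * z ^ n * C_derive h z)%C.

Definition schwarz (w : C -> C) : Prop :=
  analytic_in_disk w /\ w (RtoC 0) = RtoC 0 /\
  (forall z : C, in_disk z -> Cmod (w z) < 1).

Definition Cexp (z : C) : C :=
  (exp (Re z) * (cos (Im z) + Ci * sin (Im z)))%C.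

(* The integral of F from 0 to z along the segment s |-> s z, 0 <= s <= 1
   (for analytic F in the disk the path does not matter).  The value of F at
   the single point 0, such as that of an integrand with a removable
   singularity there, does not affect it. *)
Definition Cint0 (F : C -> C) (z : C) : C :=
  (z * @RInt C_R_CompleteNormedModule (fun s : R => F (s * z)%C) 0 1)%C.

Definition exp_factor (alpha : R) (w : C -> C) (zeta : C) : C :=
  Cexp (2 * (1 - alpha) * Cint0 (fun t : C => w t / (t * (1 - w t))) zeta)%C.

(* Main.v *)
Require Import Defs.
From Stdlib Require Import Lra.

(** Put [u = h'] and [v = h''].  The function [Q z = z v z / u z] satisfies
    [Re Q < alpha - 1], and the wanted Schwarz function is read off from the
    equation [Q = c w / (1 - w)] with [c = 2 (1 - alpha) < 0]: it is
    [w = Q / (c + Q)].  The half-plane [c + 2 Re Q < 0] is exactly the set of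
    points closer to [0] than to [-c], so [|w| < 1]
    ([Cmod_div_shift_lt_1]); clearing the denominator [u] shows that [w] is
    analytic and vanishes at [0].

    With this [w] one has [c w t / (t (1 - w t)) = v t / u t] for [t <> 0], so
    the exponent in the representation is the integral of the logarithmic
    derivative of [u] along the segment from [0].  Since [u 0 = 1], its
    exponential is [u] itself ([Cexp_Cint0_log_derivative]).  What is left is
    [h z = int_0^z u] and [g z = int_0^z g'], where [g' = lambda z^n u]; this
    is the fundamental theorem of calculus along a segment ([Cint0_derive]).

    Integrating along segments from [0] makes everything a matter of
    functions of one real variable, so no Cauchy theory is involved.  The only
    complex analysis is that a power series convergent in the disk may be
    differentiated term by term ([converges_in_disk_derive]); applied
    repeatedly to [h] and [g], it gives the analyticity of [h'], [h''] and
    [g']. *)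

(** * Complex derivatives *)

Notation is_C_derive := (@is_derive C_AbsRing C_NormedModule).

Lemma is_derive_C_eps (f : C -> C) (z l : C) :
  is_C_derive f z l <->
  forall eps : posreal, exists delta : posreal, forall y : C,
    Cmod (y - z) < delta ->
    Cmod (f y - f z - (y - z) * l)%C <= eps * Cmod (y - z).
Proof.
split.
- intros [_ H] eps.
  destruct (H z (fun P HP => HP) eps) as [d Hd].
  exists d; intros y Hy. exact (Hd y Hy).
- intros H; split; [apply is_linear_scal_l|].
  intros x Hx eps.
  assert (E : z = x).
  { apply (@is_filter_lim_locally_unique C_AbsRing (AbsRing_NormedModule C_AbsRing)). exact Hx. }
  subst x. destruct (H eps) as [d Hd]; exists d; intros y Hy.
  exact (Hd y Hy).
Qed.

(** [C] carries two normed module structures over itself, whose topologies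
    are generated by squares and by discs.  The general rules for products and
    compositions speak of the second one, the analyticity predicate of the
    first; both have the same norm, hence the same derivatives. *)
Lemma is_derive_C_AbsRing (f : C -> C) (z l : C) :
  is_C_derive f z l <->
  @is_derive C_AbsRing (AbsRing_NormedModule C_AbsRing) f z l.
Proof.
split; intros [_ H]; (split; [apply is_linear_scal_l|exact H]).
Qed.

Lemma is_derive_C_mult (f g : C -> C) (z df dg : C) :
  is_C_derive f z df ->
  is_C_derive g z dg ->
  is_C_derive (fun x => f x * g x)%C z (df * g z + f z * dg)%C.
Proof.
intros Hf%is_derive_C_AbsRing Hg%is_derive_C_AbsRing.
apply is_derive_C_AbsRing.
exact (@is_derive_mult C_AbsRing f g z df dg Hf Hg Cmult_comm).
Qed.

Lemma is_derive_C_inv (z : C) :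
  z <> RtoC 0 ->
  is_C_derive Cinv z (- / z ^ 2)%C.
Proof.
intros Hz. apply is_derive_C_eps. intros eps.
assert (Hm : 0 < Cmod z) by (apply Cmod_gt_0; exact Hz).
set (m := Cmod z) in *.
(* The first bound keeps [|y| >= m / 2]; the second absorbs the remainder
   [|y - z|^2 / (|y| m^2) <= 2 |y - z|^2 / m^3]. *)
assert (Hpos : 0 < Rmin (m / 2) (eps * m ^ 3 / 2)).
{ apply Rmin_pos; [lra|].
  assert (0 < eps * m ^ 3); [|lra].
  apply Rmult_lt_0_compat; [apply eps|apply pow_lt, Hm]. }
exists (mkposreal _ Hpos); simpl pos; intros y Hy.
assert (H1 := Rlt_le_trans _ _ _ Hy (Rmin_l _ _)).
assert (H2 := Rlt_le_trans _ _ _ Hy (Rmin_r _ _)).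
assert (Hyz : m / 2 <= Cmod y).
{ assert (T := Cmod_triangle y (- (y - z))). rewrite Cmod_opp in T.
  replace (y + - (y - z))%C with z in T by ring. fold m in T. lra. }
assert (Hy0 : y <> RtoC 0).
{ apply Cmod_gt_0. lra. }
replace (/ y - / z - (y - z) * (- / z ^ 2))%C
  with ((y - z) * ((y - z) / (y * z ^ 2)))%C by (field; auto).
rewrite Cmod_mult, Rmult_comm.
apply Rmult_le_compat_r; [apply Cmod_ge_0|].
rewrite Cmod_div, Cmod_mult, Cmod_pow.
2:{ intros E. apply Cmod_gt_0 in Hz. apply (f_equal Cmod) in E.
    rewrite Cmod_mult, Cmod_pow, Cmod_0 in E. fold m in E.
    assert (0 < Cmod y * m ^ 2); [|lra].
    apply Rmult_lt_0_compat; [lra|apply pow_lt, Hm]. }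
fold m. set (d := Cmod (y - z)) in *.
assert (0 < m ^ 2) by (apply pow_lt, Hm).
assert (0 < Cmod y * m ^ 2) by (apply Rmult_lt_0_compat; lra).
apply Rmult_le_reg_r with (Cmod y * m ^ 2); [assumption|].
unfold Rdiv at 1. rewrite Rmult_assoc, Rinv_l, Rmult_1_r by lra.
apply Rle_trans with (eps * (m / 2 * m ^ 2)).
- simpl in *. lra.
- apply Rmult_le_compat_l; [apply Rlt_le, eps|].
  apply Rmult_le_compat_r; lra.
Qed.

Lemma is_derive_C_div (f g : C -> C) (z df dg : C) :
  is_C_derive f z df ->
  is_C_derive g z dg ->
  g z <> RtoC 0 ->
  is_C_derive (fun x => f x / g x)%C z
    ((df * g z - f z * dg) / g z ^ 2)%C.
Proof.
intros Hf Hg Hz.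
assert (Hi : is_C_derive (fun x => / g x)%C z (dg * (- / g z ^ 2))%C).
{ apply is_derive_C_AbsRing in Hg.
  exact (@is_derive_comp C_AbsRing C_NormedModule Cinv g z _ _ (is_derive_C_inv _ Hz) Hg). }
assert (H := is_derive_C_mult _ _ _ _ _ Hf Hi).
refine (eq_ind _ (fun v => is_C_derive _ z v) H _ _).
match goal with |- @eq _ ?x ?y => change (@eq C x y) end.
field; exact Hz.
Qed.

Lemma analytic_const (c : C) : analytic_in_disk (fun _ => c).
Proof. intros z _. exists (RtoC 0). exact (@is_derive_const C_AbsRing C_NormedModule c z). Qed.

Lemma analytic_id : analytic_in_disk (fun z => z).
Proof. intros z _. exists (RtoC 1). apply is_derive_C_AbsRing. exact (@is_derive_id C_AbsRing z). Qed.

Lemma analytic_plus (f g : C -> C) :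
  analytic_in_disk f -> analytic_in_disk g -> analytic_in_disk (fun z => f z + g z)%C.
Proof.
intros Hf Hg z Hz. exact (@ex_derive_plus C_AbsRing C_NormedModule f g z (Hf z Hz) (Hg z Hz)).
Qed.

Lemma analytic_mult (f g : C -> C) :
  analytic_in_disk f -> analytic_in_disk g -> analytic_in_disk (fun z => f z * g z)%C.
Proof.
intros Hf Hg z Hz. destruct (Hf z Hz) as [df Df]; destruct (Hg z Hz) as [dg Dg].
eexists. apply is_derive_C_mult; eassumption.
Qed.

Lemma analytic_pow (n : nat) : analytic_in_disk (fun z => z ^ n)%C.
Proof.
induction n as [|n IH].
- exact (analytic_const 1).
- exact (analytic_mult _ _ analytic_id IH).
Qed.

Lemma analytic_div (f g : C -> C) :
  analytic_in_disk f -> analytic_in_disk g ->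
  (forall z, in_disk z -> g z <> RtoC 0) -> analytic_in_disk (fun z => f z / g z)%C.
Proof.
intros Hf Hg H0 z Hz. destruct (Hf z Hz) as [df Df]; destruct (Hg z Hz) as [dg Dg].
eexists. apply is_derive_C_div; [eassumption|eassumption|apply H0, Hz].
Qed.

(** * Termwise differentiation of power series *)

Definition converges_in_disk (a : nat -> C) (h : C -> C) : Prop :=
  forall z, in_disk z -> @is_pseries C_AbsRing C_NormedModule a z (h z).

Definition PSC_derive (a : nat -> C) (k : nat) : C := (INR (S k) * a (S k))%C.

Lemma converges_in_disk_at_0 (a : nat -> C) (h : C -> C) :
  converges_in_disk a h -> h (RtoC 0) = a 0%nat.
Proof.
intros Ha.
assert (D : in_disk 0) by (unfold in_disk; rewrite Cmod_0; lra).
exact (filterlim_locally_unique _ _ _ (Ha 0 D) (@is_pseries_0 C_AbsRing C_NormedModule a)).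
Qed.

(** Induction on [k]: if [D k] is the quantity inside the modulus on the left,
    then [D (k + 1) = y D k + (k + 1) z^k (y - z)^2].  The predecessor is harmless
    at [k = 0], where the factor [INR k] vanishes. *)
Lemma pow_first_order_bound (y z : C) (r : R) (k : nat) :
  Cmod y <= r -> Cmod z <= r ->
  Cmod (y ^ S k - z ^ S k - INR (S k) * z ^ k * (y - z))%C
  <= INR k * INR (S k) * r ^ pred k * Cmod (y - z) ^ 2.
Proof.
intros Hy Hz.
assert (Hr : 0 <= r) by (apply Rle_trans with (2 := Hy), Cmod_ge_0).
induction k as [|k IH].
- replace (y ^ 1 - z ^ 1 - INR 1 * z ^ 0 * (y - z))%C with (RtoC 0)
    by (simpl; ring).
  rewrite Cmod_0; simpl; lra.
- replace (y ^ S (S k) - z ^ S (S k) - INR (S (S k)) * z ^ S k * (y - z))%C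
    with (y * (y ^ S k - z ^ S k - INR (S k) * z ^ k * (y - z))
          + INR (S k) * z ^ k * (y - z) ^ 2)%C
    by (rewrite (S_INR (S k)), RtoC_plus; simpl; ring).
  apply Rle_trans with (1 := Cmod_triangle _ _).
  rewrite !Cmod_mult, !Cmod_pow, Cmod_R, (Rabs_pos_eq (INR (S k)))
    by apply pos_INR.
  set (d := Cmod (y - z)) in *.
  assert (Hd : 0 <= d ^ 2) by (apply pow2_ge_0).
  assert (Hk := pos_INR k). assert (HSk := S_INR k).
  assert (Hrk : 0 <= r ^ k) by (apply pow_le; lra).
  assert (Hzk : Cmod z ^ k <= r ^ k)
    by (apply pow_incr; split; [apply Cmod_ge_0|exact Hz]).
  assert (E : INR k * (r * r ^ pred k) = INR k * r ^ k)
    by (destruct k; simpl; ring).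
  apply Rle_trans with
    (r * (INR k * INR (S k) * r ^ pred k * d ^ 2) + INR (S k) * r ^ k * d ^ 2).
  + apply Rplus_le_compat.
    * apply Rmult_le_compat; auto using Cmod_ge_0.
    * apply Rmult_le_compat_r; [exact Hd|].
      apply Rmult_le_compat_l; [lra|exact Hzk].
  + replace (r * (INR k * INR (S k) * r ^ pred k * d ^ 2))
      with (INR k * (r * r ^ pred k) * INR (S k) * d ^ 2) by ring.
    rewrite E, (S_INR (S k)), HSk; simpl pred.
    assert (0 <= r ^ k * d ^ 2) by (apply Rmult_le_pos; assumption).
    nra.
Qed.

Lemma is_series_norm_le (d : nat -> C) (L : C) (B : nat -> R) :
  @is_series C_AbsRing C_NormedModule d L ->
  (forall k, Cmod (d k) <= B k) -> ex_series B -> Cmod L <= Series B.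
Proof.
intros Hd HB Hex.
assert (Hlim : is_lim_seq (fun n => @norm C_AbsRing C_NormedModule (sum_n d n))
          (@norm C_AbsRing C_NormedModule L)).
{ unfold is_lim_seq. eapply filterlim_comp; [exact Hd|].
  exact (@filterlim_norm C_AbsRing C_NormedModule L). }
apply (is_lim_seq_le _ (sum_n B) (Cmod L) (Series B) (fun n =>
   Rle_trans _ _ _ (norm_sum_n_m d 0 n) (sum_n_m_le _ _ 0 n HB)) Hlim).
exact (Series_correct B Hex).
Qed.

(** For [r < rho < 1] the terms [a k rho^k] of a convergent series are
    bounded, so the radius of convergence of the series of moduli is at least
    [rho]. *)
Lemma CV_radius_disk (a : nat -> C) (h : C -> C) :
  converges_in_disk a h ->
  forall r, 0 <= r < 1 -> Rbar_lt r (CV_radius (fun k => Cmod (a k))).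
Proof.
intros Ha r Hr.
set (rho := (r + 1) / 2).
assert (Hrho : 0 < rho < 1) by (unfold rho; lra).
apply Rbar_lt_le_trans with rho; [simpl; unfold rho; lra|].
apply (proj1 (CV_radius_bounded _)).
assert (Hs := Ha (RtoC rho)).
assert (D : in_disk rho) by (unfold in_disk; rewrite Cmod_R, Rabs_pos_eq; lra).
specialize (Hs D); unfold is_pseries in Hs.
destruct (filterlim_bounded _ (ex_intro _ _ Hs)) as [M HM].
(* Each term is the difference of two consecutive partial sums, and these
   are bounded by [M]. *)
exists (2 * M). intros n.
replace (Rabs (Cmod (a n) * rho ^ n)) with (Cmod (rho ^ n * a n)).
2:{ rewrite Cmod_mult, Cmod_pow, Cmod_R, (Rabs_pos_eq rho) by lra.
    rewrite Rabs_pos_eq; [ring|].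
    apply Rmult_le_pos; [apply Cmod_ge_0|apply pow_le; lra]. }
set (t := fun k => @scal C_AbsRing C_NormedModule (pow_n (RtoC rho) k) (a k)) in *.
assert (Et : (rho ^ n * a n)%C = t n).
{ reflexivity. }
rewrite Et.
assert (M0 : Cmod (sum_n t 0) <= M) by exact (HM 0%nat).
destruct n as [|n].
- rewrite sum_O in M0. assert (H := Cmod_ge_0 (t 0%nat)). lra.
- assert (H1 : Cmod (sum_n t n) <= M) by exact (HM n).
  assert (H2 : Cmod (sum_n t (S n)) <= M) by exact (HM (S n)).
  replace (t (S n)) with (sum_n t (S n) + - sum_n t n)%C.
  + eapply Rle_trans; [apply Cmod_triangle|]. rewrite Cmod_opp. lra.
  + rewrite sum_Sn. change (sum_n t n + t (S n) + - sum_n t n = t (S n))%C. ring.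
Qed.

(** Differentiating a real power series keeps its radius of convergence.  The
    first series dominates the termwise derivative at points of modulus [r];
    the second one, which is the termwise second derivative shifted by one
    index, dominates the remainders of [pow_first_order_bound]. *)
Lemma ex_series_derived_coefficients (a : nat -> C) (h : C -> C) (r : R) :
  converges_in_disk a h -> 0 <= r < 1 ->
  ex_series (fun k => INR (S k) * Cmod (a (S k)) * r ^ k) /\
  ex_series (fun k => INR k * INR (S k) * r ^ pred k * Cmod (a (S k))).
Proof.
intros Ha Hr.
assert (H := CV_radius_disk a h Ha r Hr).
set (A := fun k => Cmod (a k)) in *.
assert (Hp : forall k, 0 <= r ^ k) by (intro; apply pow_le; lra).
split.
- rewrite <- (CV_radius_derive A) in H.
  rewrite <- (Rabs_pos_eq r) in H by lra.
  apply CV_disk_inside in H. revert H; apply ex_series_ext; intros k.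
  unfold PS_derive. apply Rabs_pos_eq.
  repeat apply Rmult_le_pos; auto using pos_INR, Cmod_ge_0.
- rewrite <- (CV_radius_derive A) in H.
  rewrite <- (CV_radius_derive (PS_derive A)) in H.
  rewrite <- (Rabs_pos_eq r) in H by lra.
  apply CV_disk_inside in H. apply ex_series_incr_1.
  revert H; apply ex_series_ext; intros k.
  unfold PS_derive, A. rewrite Rabs_pos_eq.
  + match goal with |- @eq _ ?x ?y => change (@eq R x y) end.
    simpl pred. ring.
  + repeat apply Rmult_le_pos; auto using pos_INR, Cmod_ge_0.
Qed.

(** Summing [pow_first_order_bound] over the series bounds the remainder
    [h y - h z - (y - z) l] by a constant times [|y - z|^2] as long as [y]
    stays in a disc of radius [r < 1] around [0]. *)
Lemma converges_in_disk_derive (a : nat -> C) (h : C -> C) :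
  converges_in_disk a h ->
  forall z, in_disk z ->
    is_C_derive h z (C_derive h z) /\
    @is_pseries C_AbsRing C_NormedModule (PSC_derive a) z (C_derive h z).
Proof.
intros Ha z Hz. unfold in_disk in Hz.
assert (Hz0 := Cmod_ge_0 z).
assert (Hex : @ex_series C_AbsRing C_CompleteNormedModule
   (fun k => scal (@pow_n C_AbsRing z k) (PSC_derive a k))).
{ eapply ex_series_le;
    [|exact (proj1 (ex_series_derived_coefficients a h (Cmod z) Ha (conj Hz0 Hz)))].
  intros k.
  change (Cmod (z ^ k * (INR (S k) * a (S k))) <= INR (S k) * Cmod (a (S k)) * Cmod z ^ k).
  rewrite !Cmod_mult, Cmod_pow, Cmod_R, Rabs_pos_eq by apply pos_INR.
  apply Req_le; ring. }
destruct Hex as [l Hl].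
assert (Hd : is_C_derive h z l).
{ apply is_derive_C_eps. intros eps.
  (* A radius strictly between [|z|] and [1], so that a whole neighbourhood of
     [z] lies in the disc of radius [r]. *)
  set (r := (Cmod z + 1) / 2).
  assert (Hr : 0 <= r < 1) by (unfold r; lra).
  set (B := fun k => INR k * INR (S k) * r ^ pred k * Cmod (a (S k))).
  assert (HB : ex_series B) by exact (proj2 (ex_series_derived_coefficients a h r Ha Hr)).
  assert (Main : forall y, Cmod y <= r ->
    Cmod (h y - h z - (y - z) * l)%C <= Series B * Cmod (y - z) ^ 2).
  { intros y Hy.
    assert (Hyd : in_disk y) by (unfold in_disk; lra).
    set (d := Cmod (y - z)).
    rewrite Rmult_comm, <- Series_scal_l.
    apply is_series_norm_le with (d := fun k =>
      (a (S k) * (y ^ S k - z ^ S k - INR (S k) * z ^ k * (y - z)))%C).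
    - assert (S1 := is_series_minus _ _ _ _ (Ha y Hyd) (Ha z Hz)).
      set (t := fun k => plus (scal (@pow_n C_AbsRing y k) (a k))
                 (opp (scal (@pow_n C_AbsRing z k) (a k)))) in S1.
      (* The terms of index [0] cancel, so the difference of the two series may
         start at index [1], aligned with the derived series. *)
      assert (S2 : @is_series C_AbsRing C_NormedModule (fun k => t (S k)) (h y - h z)%C).
      { apply is_series_incr_1.
        refine (eq_ind _ (fun v => is_series t v) S1 _ _).
        unfold t; simpl.
        change (h y + - h z = h y - h z + (1 * a 0%nat + - (1 * a 0%nat)))%C. ring. }
      assert (S3 := is_series_scal (y - z)%C _ _ Hl).
      assert (S4 := is_series_minus _ _ _ _ S2 S3).
      revert S4. apply is_series_ext. intros k. unfold t.
      change ((y ^ S k * a (S k) + - (z ^ S k * a (S k))) +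
        - ((y - z) * (z ^ k * (INR (S k) * a (S k)))) =
        a (S k) * (y ^ S k - z ^ S k - INR (S k) * z ^ k * (y - z)))%C.
      ring.
    - intros k. rewrite Cmod_mult.
      assert (P := pow_first_order_bound y z r k Hy ltac:(unfold r; lra)).
      unfold B. fold d in P |- *.
      assert (H := Rmult_le_compat_l _ _ _ (Cmod_ge_0 (a (S k))) P).
      eapply Rle_trans; [exact H|]. apply Req_le; ring.
    - exact (ex_series_scal_l (d ^ 2) B HB). }
  set (K := Rabs (Series B) + 1).
  assert (HK : 0 < K) by (unfold K; generalize (Rabs_pos (Series B)); lra).
  assert (HKB : Series B <= K) by (unfold K; generalize (Rle_abs (Series B)); lra).
  assert (Hpos : 0 < Rmin (r - Cmod z) (eps / K)).
  { apply Rmin_pos; [unfold r; lra|].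
    apply Rdiv_lt_0_compat; [apply eps|exact HK]. }
  exists (mkposreal _ Hpos); simpl; intros y Hy.
  assert (H1 := Rlt_le_trans _ _ _ Hy (Rmin_l _ _)).
  assert (H2 := Rlt_le_trans _ _ _ Hy (Rmin_r _ _)).
  assert (Hyr : Cmod y <= r).
  { replace y with ((y - z) + z)%C by ring.
    eapply Rle_trans; [apply Cmod_triangle|]. lra. }
  eapply Rle_trans; [apply Main, Hyr|].
  assert (Hd0 := Cmod_ge_0 (y - z)%C).
  set (d := Cmod (y - z)) in *.
  assert (H3 : K * d <= eps).
  { apply Rlt_le in H2. apply Rmult_le_compat_l with (r := K) in H2; [|lra].
    replace (K * (eps / K)) with (pos eps) in H2 by (field; lra).
    exact H2. }
  simpl. nra. }
rewrite (is_C_derive_unique _ _ _ Hd). split; assumption.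
Qed.

(** * Calculus along segments from the origin *)

Lemma is_derive_along_ray (F : C -> C) (zeta l : C) (s : R) :
  is_C_derive F (s * zeta)%C l ->
  @is_derive R_AbsRing C_R_NormedModule (fun t : R => F (t * zeta)%C) s (zeta * l)%C.
Proof.
intros H.
split; [apply is_linear_scal_l|].
intros x Hx eps.
assert (E : s = x) by exact (is_filter_lim_locally_unique _ _ Hx). subst x.
(* The [+ 1] avoids a division by zero when [zeta = 0]. *)
set (m := Cmod zeta + 1).
assert (Hz := Cmod_ge_0 zeta).
assert (Hm : 0 < m) by (unfold m; lra).
assert (He : 0 < eps / m) by (apply Rdiv_lt_0_compat; [apply eps|exact Hm]).
destruct (proj1 (is_derive_C_eps _ _ _) H (mkposreal _ He)) as [d Hd].
assert (Hdm : 0 < d / m) by (apply Rdiv_lt_0_compat; [apply d|exact Hm]).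
exists (mkposreal _ Hdm); intros t Ht.
change (Rabs (t - s) < d / m) in Ht.
eapply Rle_trans; [apply Req_le, eq_sym, Cmod_norm|].
change (Cmod (F (t * zeta) - F (s * zeta) - (((t - s) * Re (zeta * l))%R, ((t - s) * Im (zeta * l))%R))%C
  <= eps * Rabs (t - s)).
replace ((((t - s) * Re (zeta * l))%R, ((t - s) * Im (zeta * l))%R) : C)
  with ((t * zeta - s * zeta) * l)%C.
2:{ replace (t * zeta - s * zeta)%C with ((t - s)%R * zeta)%C
      by (rewrite RtoC_minus; ring).
    rewrite <- Cmult_assoc. apply injective_projections; simpl; ring. }
assert (Q : Cmod (t * zeta - s * zeta) <= Rabs (t - s) * m).
{ replace (t * zeta - s * zeta)%C with ((t - s)%R * zeta)%C
      by (rewrite RtoC_minus; ring).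
  rewrite Cmod_mult, Cmod_R. apply Rmult_le_compat_l; [apply Rabs_pos|unfold m; lra]. }
eapply Rle_trans; [apply Hd|].
- eapply Rle_lt_trans; [exact Q|].
  apply Rmult_lt_compat_r with (r := m) in Ht; [|exact Hm].
  replace (d / m * m) with (pos d) in Ht by (field; lra). exact Ht.
- simpl. apply Rle_trans with (eps / m * (Rabs (t - s) * m)).
  + apply Rmult_le_compat_l; [lra|exact Q].
  + apply Req_le; field; lra.
Qed.

Lemma in_disk_ray (s : R) (z : C) : 0 <= s <= 1 -> in_disk z -> in_disk (s * z)%C.
Proof.
unfold in_disk; intros Hs Hz. assert (H := Cmod_ge_0 z).
rewrite Cmod_mult, Cmod_R, Rabs_pos_eq by lra. nra.
Qed.

Lemma analytic_continuous_along_ray (F : C -> C) (zeta : C) (s : R) :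
  analytic_in_disk F -> in_disk (s * zeta)%C ->
  @continuous R_UniformSpace C_UniformSpace (fun t : R => F (t * zeta)%C) s.
Proof.
intros HF Hs. destruct (HF _ Hs) as [l Hl].
apply (@ex_derive_continuous R_AbsRing C_R_NormedModule).
exists (zeta * l)%C. apply is_derive_along_ray, Hl.
Qed.

Lemma analytic_ex_RInt_ray (F : C -> C) (zeta : C) (b : R) :
  analytic_in_disk F -> Rabs b * Cmod zeta < 1 ->
  @ex_RInt C_R_NormedModule (fun s : R => F (s * zeta)%C) 0 b.
Proof.
intros HF Hb. apply (@ex_RInt_continuous C_R_CompleteNormedModule).
intros s Hs. apply analytic_continuous_along_ray; [exact HF|].
unfold in_disk. rewrite Cmod_mult, Cmod_R.
eapply Rle_lt_trans; [|exact Hb].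
apply Rmult_le_compat_r; [apply Cmod_ge_0|].
unfold Rmin, Rmax, Rabs in *; repeat destruct Rle_dec; repeat destruct Rcase_abs; lra.
Qed.

Lemma is_RInt_C_scal (c : C) (f : R -> C) (a b : R) (l : C) :
  @is_RInt C_R_NormedModule f a b l ->
  @is_RInt C_R_NormedModule (fun s => c * f s)%C a b (c * l)%C.
Proof.
intros H.
assert (H1 := is_RInt_fct_extend_fst f a b l H : is_RInt (fun s => Re (f s)) a b (Re l)).
assert (H2 := is_RInt_fct_extend_snd f a b l H : is_RInt (fun s => Im (f s)) a b (Im l)).
apply (@is_RInt_fct_extend_pair R_NormedModule R_NormedModule).
- exact (is_RInt_minus _ _ _ _ _ _ (is_RInt_scal _ _ _ (Re c) _ H1) (is_RInt_scal _ _ _ (Im c) _ H2)).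
- exact (is_RInt_plus _ _ _ _ _ _ (is_RInt_scal _ _ _ (Re c) _ H2) (is_RInt_scal _ _ _ (Im c) _ H1)).
Qed.

Lemma Cint0_scal (c : C) (F : C -> C) (z : C) :
  analytic_in_disk F -> in_disk z ->
  Cint0 (fun t => c * F t)%C z = (c * Cint0 F z)%C.
Proof.
intros HF Hz. unfold Cint0.
assert (H := analytic_ex_RInt_ray F z 1 HF ltac:(rewrite Rabs_R1, Rmult_1_l; exact Hz)).
apply (@RInt_correct C_R_CompleteNormedModule) in H.
apply (is_RInt_C_scal c) in H.
apply (@is_RInt_unique C_R_CompleteNormedModule) in H. rewrite H. ring.
Qed.

(** Changing an integrand at [0] only affects one endpoint of the segment,
    unless [z = 0], and then the factor [z] makes both sides vanish.  This is
    what disposes of the removable singularity of [w t / (t (1 - w t))]. *)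
Lemma Cint0_ext (F G : C -> C) (z : C) :
  in_disk z -> (forall t, in_disk t -> t <> RtoC 0 -> F t = G t) ->
  Cint0 F z = Cint0 G z.
Proof.
intros Hz HFG. unfold Cint0.
destruct (Ceq_dec z 0) as [->|Hz0]; [ring|].
f_equal. apply RInt_ext. intros s Hs.
rewrite Rmin_left, Rmax_right in Hs by lra.
apply HFG.
- apply in_disk_ray; [lra|exact Hz].
- apply Cmult_neq_0; [|exact Hz0]. intros E. apply RtoC_inj in E. lra.
Qed.

Lemma Cint0_derive (F dF : C -> C) (z : C) :
  (forall t, in_disk t -> is_C_derive F t (dF t)) ->
  analytic_in_disk dF -> in_disk z ->
  Cint0 dF z = (F z - F (RtoC 0))%C.
Proof.
intros HF HdF Hz.
assert (H : @is_RInt C_R_NormedModule (fun s : R => z * dF (s * z))%C 0 1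
   (minus (F (1 * z)%C) (F (0 * z)%C))).
{ apply (@is_RInt_derive C_R_CompleteNormedModule (fun s : R => F (s * z)%C)); intros s Hs;
  rewrite Rmin_left, Rmax_right in Hs by lra.
  - apply is_derive_along_ray, HF, in_disk_ray; assumption.
  - apply (analytic_continuous_along_ray (fun t => z * dF t)%C z s).
    + exact (analytic_mult _ _ (analytic_const z) HdF).
    + apply in_disk_ray; assumption. }
rewrite Cmult_1_l, Cmult_0_l in H.
unfold Cint0.
assert (H0 := analytic_ex_RInt_ray dF z 1 HdF ltac:(rewrite Rabs_R1, Rmult_1_l; exact Hz)).
apply (@RInt_correct C_R_CompleteNormedModule) in H0.
apply (is_RInt_C_scal z) in H0.
apply (@is_RInt_unique C_R_CompleteNormedModule) in H0.
apply (@is_RInt_unique C_R_CompleteNormedModule) in H.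
etransitivity; [symmetry; exact H0|exact H].
Qed.

Lemma is_derive_RInt_ray (F : C -> C) (zeta : C) (s : R) :
  analytic_in_disk F -> in_disk zeta -> 0 <= s <= 1 ->
  @is_derive R_AbsRing C_R_NormedModule
    (fun b => zeta * @RInt C_R_CompleteNormedModule (fun r : R => F (r * zeta)%C) 0 b)%C
    s (zeta * F (s * zeta))%C.
Proof.
intros HF Hz Hs.
assert (HF' : analytic_in_disk (fun t => zeta * F t)%C).
{ exact (analytic_mult _ _ (analytic_const zeta) HF). }
apply (@is_derive_RInt C_R_NormedModule (fun r : R => zeta * F (r * zeta))%C _ 0).
2:{ apply (analytic_continuous_along_ray (fun t => zeta * F t)%C zeta s HF').
    apply in_disk_ray; assumption. }
unfold in_disk in Hz. assert (H0 := Cmod_ge_0 zeta).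
(* With [x = |zeta|], a parameter [b] within [1 - x] of [s] satisfies
   [|b| x < (2 - x) x = 1 - (1 - x)^2]. *)
assert (Hd : 0 < 1 - Cmod zeta) by lra.
exists (mkposreal _ Hd). intros b Hb.
change (Rabs (b - s) < 1 - Cmod zeta) in Hb.
apply is_RInt_C_scal. apply (@RInt_correct C_R_CompleteNormedModule).
apply analytic_ex_RInt_ray; [exact HF|].
assert (Hb' : Rabs b < 2 - Cmod zeta).
{ replace b with ((b - s) + s) by ring.
  eapply Rle_lt_trans; [apply Rabs_triang|]. rewrite (Rabs_pos_eq s) by lra. lra. }
nra.
Qed.

Lemma is_derive_Re (f : R -> C) (s : R) (l : C) :
  @is_derive R_AbsRing C_R_NormedModule f s l -> is_derive (fun t => Re (f t)) s (Re l).
Proof.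
intros H.
exact (filterdiff_comp' f fst s _ _ H (filterdiff_linear _ is_linear_fst)).
Qed.

Lemma is_derive_Im (f : R -> C) (s : R) (l : C) :
  @is_derive R_AbsRing C_R_NormedModule f s l -> is_derive (fun t => Im (f t)) s (Im l).
Proof.
intros H.
exact (filterdiff_comp' f snd s _ _ H (filterdiff_linear _ is_linear_snd)).
Qed.

(** * The exponential of an integrated logarithmic derivative *)

Lemma Cexp_Re_Im (z : C) : Cexp z = (exp (Re z) * cos (Im z), exp (Re z) * sin (Im z)).
Proof. unfold Cexp. apply injective_projections; simpl; ring. Qed.

(** This is the uniqueness of the solution of [u' = e' u], [u 0 = 1], written
    for the real and imaginary parts of [u = u1 + i u2], [e = e1 + i e2] and
    [e' = d1 + i d2]: the two parts of [u exp (- e)] have derivative zero. *)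
Lemma real_log_derivative (u1 u2 e1 e2 d1 d2 : R -> R) :
  (forall s, 0 <= s <= 1 ->
     is_derive u1 s (d1 s * u1 s - d2 s * u2 s) /\
     is_derive u2 s (d1 s * u2 s + d2 s * u1 s) /\
     is_derive e1 s (d1 s) /\ is_derive e2 s (d2 s)) ->
  u1 0 = 1 -> u2 0 = 0 -> e1 0 = 0 -> e2 0 = 0 ->
  u1 1 = exp (e1 1) * cos (e2 1) /\ u2 1 = exp (e1 1) * sin (e2 1).
Proof.
intros H U1 U2 E1 E2.
set (p := fun s => exp (- e1 s) * (u1 s * cos (e2 s) + u2 s * sin (e2 s))).
set (q := fun s => exp (- e1 s) * (u2 s * cos (e2 s) - u1 s * sin (e2 s))).
assert (Hp : p 0 = p 1).
{ apply eq_is_derive; [|lra]. intros s Hs.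
  destruct (H s Hs) as (A1 & A2 & A3 & A4). unfold p. auto_derive.
  - repeat split; eexists; eassumption.
  - rewrite (is_derive_unique (fun t : R => u1 t) _ _ A1),
      (is_derive_unique (fun t : R => u2 t) _ _ A2),
      (is_derive_unique (fun t : R => e1 t) _ _ A3),
      (is_derive_unique (fun t : R => e2 t) _ _ A4).
    change (@zero _) with 0. ring. }
assert (Hq : q 0 = q 1).
{ apply eq_is_derive; [|lra]. intros s Hs.
  destruct (H s Hs) as (A1 & A2 & A3 & A4). unfold q. auto_derive.
  - repeat split; eexists; eassumption.
  - rewrite (is_derive_unique (fun t : R => u1 t) _ _ A1),
      (is_derive_unique (fun t : R => u2 t) _ _ A2),
      (is_derive_unique (fun t : R => e1 t) _ _ A3),
      (is_derive_unique (fun t : R => e2 t) _ _ A4).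
    change (@zero _) with 0. ring. }
unfold p in Hp; unfold q in Hq.
rewrite U1, U2, E1, E2, Ropp_0, exp_0, cos_0, sin_0 in Hp, Hq.
assert (Hx : exp (e1 1) * exp (- e1 1) = 1) by (rewrite <- exp_plus, Rplus_opp_r; apply exp_0).
assert (Hcs := sin2_cos2 (e2 1)). unfold Rsqr in Hcs.
set (x := exp (e1 1)) in *. set (y := exp (- e1 1)) in *.
set (c := cos (e2 1)) in *. set (s := sin (e2 1)) in *.
split.
- replace (u1 1) with (x * y * (s * s + c * c) * u1 1) by (rewrite Hx, Hcs; ring).
  (* The factors [1 * (1 * 1 + 0 * 0)] and [1 * (0 * 1 - 1 * 0)] are [p 0] and
     [q 0], kept in this form so that they can be traded for [p 1] and [q 1]. *)
  replace (x * c) with (x * ((1 * (1 * 1 + 0 * 0)) * c - (1 * (0 * 1 - 1 * 0)) * s)) by ring.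
  rewrite Hp, Hq. ring.
- replace (u2 1) with (x * y * (s * s + c * c) * u2 1) by (rewrite Hx, Hcs; ring).
  replace (x * s) with (x * ((1 * (1 * 1 + 0 * 0)) * s + (1 * (0 * 1 - 1 * 0)) * c)) by ring.
  rewrite Hp, Hq. ring.
Qed.

(** The equation of [real_log_derivative] is satisfied by
    [s |-> u (s zeta)] and by the integral of [v / u] from [0] to
    [s zeta]. *)
Lemma Cexp_Cint0_log_derivative (u v : C -> C) (zeta : C) :
  (forall t, in_disk t -> is_C_derive u t (v t)) ->
  (forall t, in_disk t -> u t <> RtoC 0) ->
  analytic_in_disk (fun t => v t / u t)%C -> u (RtoC 0) = RtoC 1 -> in_disk zeta ->
  Cexp (Cint0 (fun t => v t / u t)%C zeta) = u zeta.
Proof.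
intros Hu Hu0 HG Hu1 Hz.
set (G := fun t => (v t / u t)%C) in *.
set (U := fun s : R => u (s * zeta)%C).
set (E := fun b => (zeta * @RInt C_R_CompleteNormedModule (fun r : R => G (r * zeta)%C) 0 b)%C).
assert (HE0 : E 0 = RtoC 0).
{ unfold E. rewrite RInt_point. apply Cmult_0_r. }
assert (HU0 : U 0 = RtoC 1) by (unfold U; rewrite Cmult_0_l; exact Hu1).
assert (HU1 : U 1 = u zeta) by (unfold U; rewrite Cmult_1_l; reflexivity).
assert (H := real_log_derivative (fun s => Re (U s)) (fun s => Im (U s))
   (fun s => Re (E s)) (fun s => Im (E s))
   (fun s => Re (zeta * G (s * zeta)%C)) (fun s => Im (zeta * G (s * zeta)%C))).
cbv beta in H. rewrite HE0, HU0, HU1 in H.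
destruct H as [H1 H2]; try reflexivity.
2:{ change (Cint0 G zeta) with (E 1). rewrite Cexp_Re_Im, <- H1, <- H2.
    destruct (u zeta); reflexivity. }
intros s Hs.
assert (Hsd := in_disk_ray s zeta Hs Hz).
assert (DE := is_derive_RInt_ray G zeta s HG Hz Hs).
assert (DU := is_derive_along_ray u zeta _ s (Hu _ Hsd)).
fold E in DE. fold U in DU.
assert (EQ : (zeta * v (s * zeta))%C = (zeta * G (s * zeta) * U s)%C).
{ unfold G, U. field. apply Hu0, Hsd. }
rewrite EQ in DU.
assert (D1 := is_derive_Re _ _ _ DU). assert (D2 := is_derive_Im _ _ _ DU).
rewrite re_mult in D1. rewrite im_mult in D2.
exact (conj D1 (conj D2 (conj (is_derive_Re _ _ _ DE) (is_derive_Im _ _ _ DE)))).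
Qed.

(** * The Schwarz function *)

(** [|c + Q|^2 - |Q|^2 = c (c + 2 Re Q)] is a product of two negative
    numbers. *)
Lemma Cmod_div_shift_lt_1 (c : R) (Q : C) :
  c < 0 -> c + 2 * Re Q < 0 ->
  (c + Q <> 0)%C /\ Cmod (Q / (c + Q)) < 1.
Proof.
intros Hc HQ.
assert (H : Cmod Q < Cmod (c + Q)).
{ apply Rsqr_incrst_0; auto using Cmod_ge_0.
  rewrite !Rsqr_pow2, !Cmod2_alt, re_plus, im_plus, re_RtoC, im_RtoC. nra. }
assert (H0 := Cmod_ge_0 Q).
assert (Hne : (c + Q <> 0)%C) by (apply Cmod_gt_0; lra).
split; [exact Hne|].
rewrite Cmod_div by exact Hne.
apply Rmult_lt_reg_r with (Cmod (c + Q)); [lra|].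
unfold Rdiv; rewrite Rmult_assoc, Rinv_l by lra. lra.
Qed.

Theorem theorem4 :
  forall (n : nat) (alpha : R) (lambda : C) (f : C -> C),
    (1 <= n)%nat ->
    1 < alpha <= 3 / 2 ->
    Cmod lambda <= 1 / INR (n + 1) ->
    class_F alpha lambda n f ->
    exists w : C -> C,
      schwarz w /\
      forall z : C, in_disk z ->
        f z =
        (Cint0 (exp_factor alpha w) z
         + Cconj (lambda * Cint0 (fun zeta => zeta ^ n * exp_factor alpha w zeta) z))%C.
Proof.
intros n alpha lambda f _ Halpha _ (h & g & (_ & _ & Hf & _ & _ & a & b & a0 & a1 & b0 & Hab) & HF).
assert (Ha : converges_in_disk a h) by (intros z Hz; apply Hab, Hz).
assert (Hb : converges_in_disk b g) by (intros z Hz; apply Hab, Hz).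
set (u := C_derive h) in *. set (v := C_derive u) in *.
assert (Dh := converges_in_disk_derive a h Ha). fold u in Dh.
assert (Hu : converges_in_disk (PSC_derive a) u) by (intros z Hz; apply Dh, Hz).
assert (Du := converges_in_disk_derive _ u Hu). fold v in Du.
assert (Hv : converges_in_disk (PSC_derive (PSC_derive a)) v) by (intros z Hz; apply Du, Hz).
assert (Dg := converges_in_disk_derive b g Hb).
assert (Hg' : converges_in_disk (PSC_derive b) (C_derive g)) by (intros z Hz; apply Dg, Hz).
assert (An : forall c k, converges_in_disk c k -> analytic_in_disk k).
{ intros c k Hk z Hz. exists (C_derive k z). apply (converges_in_disk_derive c k Hk z Hz). }
assert (Au := An _ _ Hu). assert (Av := An _ _ Hv). assert (Ag' := An _ _ Hg').
assert (u0 : forall z, in_disk z -> u z <> RtoC 0) by (intros z Hz; apply HF, Hz).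
set (c := 2 * (1 - alpha)).
assert (Hc : c < 0) by (unfold c; lra).
assert (Ec : (2 * (1 - alpha))%C = RtoC c)
  by (unfold c; rewrite RtoC_mult, RtoC_minus; reflexivity).
assert (c0 : RtoC c <> RtoC 0) by (intros E; apply RtoC_inj in E; lra).
assert (HQ : forall z, in_disk z ->
  (c + z * v z / u z <> 0)%C /\ Cmod (z * v z / u z / (c + z * v z / u z)) < 1).
{ intros z Hz. apply Cmod_div_shift_lt_1; [exact Hc|].
  destruct (HF z Hz) as (_ & HR & _).
  rewrite re_plus, re_RtoC in HR. unfold c. lra. }
assert (HD : forall z, in_disk z -> (c * u z + z * v z)%C <> RtoC 0).
{ intros z Hz. replace (c * u z + z * v z)%C with (u z * (c + z * v z / u z))%C
    by (field; apply u0, Hz).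
  apply Cmult_neq_0; [apply u0, Hz|apply HQ, Hz]. }
assert (AG := analytic_div v u Av Au u0).
set (w := fun z => (z * v z / (c * u z + z * v z))%C).
assert (Hw : forall z, in_disk z -> exp_factor alpha w z = u z).
{ intros z Hz. unfold exp_factor. rewrite Ec.
  (* Here [w / (t (1 - w)) = v / (c u)], because [1 - w = c u / (c u + t v)]. *)
  rewrite (Cint0_ext _ (fun t => / c * (v t / u t))%C z Hz).
  - rewrite Cint0_scal by assumption.
    replace (c * (/ c * Cint0 (fun t => v t / u t) z))%C
      with (Cint0 (fun t => v t / u t)%C z) by (field; exact c0).
    apply Cexp_Cint0_log_derivative; auto.
    + intros t Ht; apply Du, Ht.
    + rewrite (converges_in_disk_at_0 _ u Hu). unfold PSC_derive. rewrite a1. simpl. ring.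
  - intros t Ht t0. assert (D0 := HD t Ht). assert (U0 := u0 t Ht). unfold w.
    replace (1 - t * v t / (c * u t + t * v t))%C
      with (c * u t / (c * u t + t * v t))%C by (field; exact D0).
    field. auto. }
exists w. split; [split; [|split]|].
- apply analytic_div; [| |exact HD].
  + apply (analytic_mult _ _ analytic_id Av).
  + apply analytic_plus; [apply (analytic_mult _ _ (analytic_const c) Au)|].
    apply (analytic_mult _ _ analytic_id Av).
- unfold w, Cdiv. rewrite !Cmult_0_l. reflexivity.
- intros z Hz. unfold w.
  replace (z * v z / (c * u z + z * v z))%C with (z * v z / u z / (c + z * v z / u z))%C.
  + apply HQ, Hz.
  + assert (H1 := HD z Hz). assert (H2 := u0 z Hz).
    assert (H3 := proj1 (HQ z Hz)).
    replace (c + z * v z / u z)%C with ((c * u z + z * v z) / u z)%C by (field; exact H2).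
    field. auto.
- intros z Hz.
  rewrite (Cint0_ext _ u z Hz) by (intros; apply Hw; assumption).
  rewrite (Cint0_ext (fun zeta => zeta ^ n * exp_factor alpha w zeta)%C
             (fun zeta => zeta ^ n * u zeta)%C z Hz)
    by (intros; rewrite Hw by assumption; reflexivity).
  rewrite <- Cint0_scal by (try exact Hz; apply (analytic_mult _ _ (analytic_pow n) Au)).
  rewrite (Cint0_ext (fun t => lambda * (t ^ n * u t))%C (C_derive g) z Hz).
  2:{ intros t Ht _. destruct (HF t Ht) as (_ & _ & ->). fold u. ring. }
  rewrite (Cint0_derive h u), (Cint0_derive g (C_derive g)); auto.
  + rewrite (converges_in_disk_at_0 a h Ha), (converges_in_disk_at_0 b g Hb), a0, b0.
    rewrite Hf by exact Hz. f_equal; [ring|f_equal; ring].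
  + intros t Ht; apply Dg, Ht.
  + intros t Ht; apply Dh, Ht.
Qed.
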